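(* Let $(K,\Delta)$ be a Hermitian form field with $\bar{}=\mathrm{id}$, $\lambda=-1$, $\mu=1$ and $\Delta=\Delta_{\max}=0\times K$, where the field $K$ has characteristic $2$. Let $n\geq 3$ and $G=U_{2n+1}(K,\Delta)$. Let $\mathcal{C}$ denote the set of all conjugacy classes of $G$ of level $(K,\Delta)$ and let $S_{\mathrm{short}}$ denote the set of all nontrivial short root transvections in $G$. Then $\mathrm{scn}_{\mathcal{C}}(S_{\mathrm{short}})=3$ or $\mathrm{scn}_{\mathcal{C}}(S_{\mathrm{short}})=4$.
   Context: Hermitian form fields. A Hermitian form field $(K,\Delta)$ consists of the following data. $K$ is a (commutative) field with a ring automorphism $x\mapsto\bar x$, an element $\lambda\in K$ with $\bar{\bar x}=\lambda x\bar\lambda$ for all $x\in K$ (hence $\bar\lambda=\lambda^{-1}$), and an element $\mu\in K$ with $\mu=\bar\mu\lambda$. The Heisenberg group $\mathfrak{H}$ is the set $K\times K$ with group operation $(x_1,y_1)\dot{+}(x_2,y_2)=(x_1+x_2,\,y_1+y_2-\bar x_1\mu x_2)$; the inverse of $(x,y)$ is $\dot{-}(x,y)=(-x,-y-\bar x\mu x)$, and $a\dot{-}b$ means $a\dot{+}(\dot{-}b)$. For $a\in K$ put $(x,y)\circ a=(xa,\bar a y a)$. A subgroup of $\mathfrak{H}$ stable under $\circ a$ for all $a\in K$ is called a $K^\bullet$-submodule. For $A\subseteq\mathfrak H$, $B\subseteq K$, $A\circ B$ denotes the subgroup of $\mathfrak H$ generated by all $a\circ b$, $a\in A,b\in B$.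 Put $\mathrm{tr}(x,y)=\bar x\mu x+y+\bar y\lambda$, $\Delta_{\min}=\{(0,x-\bar x\lambda)\mid x\in K\}$ and $\Delta_{\max}=\{(x,y)\in\mathfrak H\mid \mathrm{tr}(x,y)=0\}$. $\Delta$ is a $K^\bullet$-submodule of $\mathfrak H$ with $\Delta_{\min}\subseteq\Delta\subseteq\Delta_{\max}$. Odd form ideals. Put $J(\Delta)=\{y\in K\mid \exists z\in K: (y,z)\in\Delta\}$. For an ideal $I$ of $K$ with $\bar x\in I$ for all $x\in I$, put $\tilde I=\{x\in K\mid \overline{J(\Delta)}\mu x\subseteq I\}$, $\Omega^I_{\min}=\{(0,x-\bar x\lambda)\mid x\in I\}\dot{+}\Delta\circ I$ and $\Omega^I_{\max}=\Delta\cap(\tilde I\times I)$. An odd form ideal of $(K,\Delta)$ is a pair $(I,\Omega)$ where $I$ is an ideal of $K$ with $\bar x\in I$ for all $x\in I$ and $\Omega$ is a $K^\bullet$-submodule of $\mathfrak H$ with $\Omega^I_{\min}\subseteq\Omega\subseteq\Omega^I_{\max}$. The unitary group. Let $M=K^{2n+1}$ (column vectors) with standard basis indexed $(e_1,\dots,e_n,e_0,e_{-n},\dots,e_{-1})$; rows and columns of $(2n+1)\times(2n+1)$ matrices are indexed in the same way. Define $B(u,v)=\sum_{i=1}^n\bar u_iv_{-i}+\bar u_0\mu v_0+\sum_{i=-n}^{-1}\bar u_i\lambda v_{-i}$ and $Q(u)=(u_0,\sum_{i=1}^n\bar u_iu_{-i})\in\mathfrak H$. Then $U_{2n+1}(K,\Delta)$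 is the group of all $\sigma\in GL_{2n+1}(K)$ with $B(\sigma u,\sigma v)=B(u,v)$ and $Q(\sigma u)\dot{-}Q(u)\in\Delta$ for all $u,v\in M$. Transvections. Let $\Theta_{\mathrm{hb}}=\{\pm1,\dots,\pm n\}$, $\epsilon(i)=1$ if $i>0$ and $\epsilon(i)=-1$ if $i<0$. Let $e$ be the identity matrix and $e^{ij}$ the matrix units. Short root transvections are the matrices $T_{ij}(x)=e+xe^{ij}-\lambda^{(\epsilon(j)-1)/2}\bar x\lambda^{(1-\epsilon(i))/2}e^{-j,-i}$ with $i,j\in\Theta_{\mathrm{hb}}$, $i\neq\pm j$, $x\in K$. For a subset $\Omega\subseteq K\times K$ put $\Omega^{1}=\Omega$ and $\Omega^{-1}=\{(x,y)\mid (x,\bar y)\in\Omega\}$. Extra short root transvections are the matrices $T_i(x,y)=e+xe^{0,-i}-\lambda^{-(1+\epsilon(i))/2}\bar x\mu e^{i0}+ye^{i,-i}$ with $i\in\Theta_{\mathrm{hb}}$, $(x,y)\in\Delta^{-\epsilon(i)}$. All these lie in $U_{2n+1}(K,\Delta)$; nontrivial means different from $e$. $E=EU_{2n+1}(K,\Delta)$ is the subgroup generated by all short and extra short root transvections. Relative subgroups. Let $(I,\Omega)$ be an odd form ideal. $T_{ij}(x)$ is $(I,\Omega)$-elementary if $x\in I$; $T_i(x,y)$ is $(I,\Omega)$-elementary if $(x,y)\in\Omega^{-\epsilon(i)}$. $EU_{2n+1}((K,\Delta),(I,\Omega))$ is the normal closure in $E$ of the subgroup generated by all $(I,\Omega)$-elementary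 transvections. $U_{2n+1}((K,\Delta),(I,\Omega))$ is the subgroup of all $\sigma\in U_{2n+1}(K,\Delta)$ with $\sigma_{ij}-\delta_{ij}\in I$ for all $i,j\in\Theta_{\mathrm{hb}}$ and $Q(\sigma u)\dot{-}Q(u)\in\Omega$ for all $u\in M$ with $u_0\in J(\Delta)$. $NU_{2n+1}((K,\Delta),(I,\Omega))$ is its normaliser in $U_{2n+1}(K,\Delta)$, and $CU_{2n+1}((K,\Delta),(I,\Omega))=\{\sigma\in NU_{2n+1}((K,\Delta),(I,\Omega))\mid [\sigma,E]\leq U_{2n+1}((K,\Delta),(I,\Omega))\}$. Level. Let $n\geq3$. It is known (Bak–Preusser) that for every subgroup $H$ of $U_{2n+1}(K,\Delta)$ normalised by $E$ there is a unique odd form ideal $(I,\Omega)$ with $EU_{2n+1}((K,\Delta),(I,\Omega))\subseteq H\subseteq CU_{2n+1}((K,\Delta),(I,\Omega))$; it is called the level of $H$. The level of a conjugacy class $C$ of $G=U_{2n+1}(K,\Delta)$ is the level of the subgroup generated by $C$. Covering numbers. For a group $G$ and subsets $S,X\subseteq G$, $\mathrm{cn}_X(S)$ is the least positive integer $m$ with $S\subseteq X^m=\{x_1\cdots x_m\mid x_i\in X\}$ ($\infty$ if there is none), and $\mathrm{scn}_X(S)=\mathrm{cn}_{X\cup X^{-1}}(S)$. For a set $\mathcal X$ of subsets of $G$, $\mathrm{scn}_{\mathcal X}(S)=\sup\{\mathrm{scn}_X(S)\mid X\in\mathcal X\}$. *)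

(* Defs.v *)
From mathcomp Require Import all_boot all_order all_algebra.
From mathcomp Require Import boolp classical_sets.

Set Implicit Arguments.
Unset Strict Implicit.
Unset Printing Implicit Defensive.
Import GRing.Theory.
Local Open Scope classical_set_scope.
Local Open Scope ring_scope.

Section Units.
(* All groups below are subgroups of the group of units of a ring R (later a
   ring of square matrices), so products and inverses are those of R. *)
Variable R : unitRingType.
Implicit Types A G H S X : set R.

Definition is_subgroup H :=
  [/\ H `<=` [set x | x \is a GRing.unit], H 1,
      forall x y, H x -> H y -> H (x * y)
    & forall x, H x -> H x^-1].

Definition generated A : set R := smallest is_subgroup A.

Definition is_normal G H :=
  [/\ is_subgroup H, H `<=` G & forall g h, G g -> H h -> H (g * h * g^-1)].

Definition normal_closure G A : set R := smallest (is_normal G) A.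

Definition normaliser G H : set R :=
  [set g | G g /\ [set g * h * g^-1 | h in H] = H].

Definition commg_subgroup A H : set R :=
  generated [set z | exists x y, [/\ A x, H y & z = x * y * x^-1 * y^-1]].

Definition is_conj_class G X :=
  exists2 x, G x & X = [set g * x * g^-1 | g in G].

Definition set_pow X (m : nat) : set R :=
  [set \prod_(i < m) f i | f in [set f : 'I_m -> R | forall i, X (f i)]].

End Units.

(* Elements of N \cup {oo} are encoded in [option nat], with [None] for oo. *)
Definition least_or_oo (P : set nat) : option nat :=
  if pselect (exists m, `[< P m >]) is left exP then Some (ex_minn exP)
  else None.

Definition nat_oo_sup (A : set (option nat)) : option nat :=
  least_or_oo [set m | forall a, A a -> exists2 k, a = Some k & (k <= m)%N].

Section Covering.
Variable R : unitRingType.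
Implicit Types S X : set R.

Definition cn X S : option nat :=
  least_or_oo [set m | (0 < m)%N /\ S `<=` set_pow X m].

Definition scn X S : option nat := cn (X `|` [set x^-1 | x in X]) S.

Definition scn_family (XX : set (set R)) S : option nat :=
  nat_oo_sup [set scn X S | X in XX].

End Covering.

Record herm_param (K : fieldType) := HermParam {
  bar : {rmorphism K -> K};
  bar_bij : bijective bar;
  lam : K;
  mu : K;
  bar_bar : forall x, bar (bar x) = lam * x * bar lam;
  mu_bar : mu = bar mu * lam }.

Section Heisenberg.
Variables (K : fieldType) (P : herm_param K).
Local Notation "x ^b" := (bar P x) (at level 2, format "x ^b").
Local Notation lam := (lam P).
Local Notation mu := (mu P).

Definition hadd (a b : K * K) : K * K :=
  (a.1 + b.1, a.2 + b.2 - a.1^b * mu * b.1).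

Definition hopp (a : K * K) : K * K := (- a.1, - a.2 - a.1^b * mu * a.1).

Definition hsub (a b : K * K) : K * K := hadd a (hopp b).

Definition hact (a : K * K) (k : K) : K * K := (a.1 * k, k^b * a.2 * k).

Definition heis_subgroup (A : set (K * K)) :=
  [/\ A (0, 0), forall a b, A a -> A b -> A (hadd a b)
    & forall a, A a -> A (hopp a)].

Definition heis_submodule (A : set (K * K)) :=
  heis_subgroup A /\ forall a k, A a -> A (hact a k).

Definition hcirc (A : set (K * K)) (B : set K) : set (K * K) :=
  smallest heis_subgroup [set hact a b | a in A & b in B].

Definition htr (a : K * K) : K := a.1^b * mu * a.1 + a.2 + a.2^b * lam.

Definition Delta_min : set (K * K) := [set (0, x - x^b * lam) | x in setT].

Definition Delta_max : set (K * K) := [set a | htr a = 0].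

End Heisenberg.

Record herm_form_field (K : fieldType) := HermFormField {
  herm_param_of :> herm_param K;
  Delta : set (K * K);
  Delta_submodule : heis_submodule herm_param_of Delta;
  Delta_min_sub : Delta_min herm_param_of `<=` Delta;
  Delta_sub_max : Delta `<=` Delta_max herm_param_of }.

Section Unitary.
Variables (K : fieldType) (F : herm_form_field K).
Local Notation "x ^b" := (bar F x) (at level 2, format "x ^b").
Local Notation lam := (lam F).
Local Notation mu := (mu F).
Local Notation Delta := (Delta F).
Implicit Types (I : set K) (Om : set (K * K)).

Definition J : set K := [set y | exists z, Delta (y, z)].

(* The unit ideal is allowed, unlike in [idealr_closed]. *)
Definition is_ideal I :=
  I 0 /\ forall a x y, I x -> I y -> I (a * x + y).

Definition bar_ideal I := is_ideal I /\ forall x, I x -> I x^b.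

Definition tilde I : set K := [set x | forall y, J y -> I (y^b * mu * x)].

Definition Omega_min I : set (K * K) :=
  [set hadd F a b | a in [set (0, x - x^b * lam) | x in I] & b in hcirc F Delta I].

Definition Omega_max I : set (K * K) := Delta `&` (tilde I `*` I).

Definition odd_form_ideal I Om :=
  [/\ bar_ideal I, heis_submodule F Om,
      Omega_min I `<=` Om & Om `<=` Omega_max I].

Variable n : nat.
Local Notation N := (n.*2.+1).
Implicit Types (i j : 'I_N) (u v : 'cV[K]_N) (s : 'M[K]_N).

(* The index list (1, ..., n, 0, -n, ..., -1) is numbered 0, ..., 2n in that
   order: the index 0 is the ordinal n, the positive indices are the ordinals
   below n, and i |-> -i is [rev_ord]. *)
Lemma idx0_subproof : (n < N)%N.
Proof. by rewrite ltnS -addnn leq_addr. Qed.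

Definition idx0 : 'I_N := Ordinal idx0_subproof.
Definition idx_pos i : bool := (i < n)%N.
Definition idx_neg i : bool := (n < i)%N.
Definition idx_hb i : bool := i != idx0.
Local Notation opp := (@rev_ord N).

Definition B u v : K :=
  \sum_(i | idx_pos i) (u i 0)^b * v (opp i) 0
  + (u idx0 0)^b * mu * v idx0 0
  + \sum_(i | idx_neg i) (u i 0)^b * lam * v (opp i) 0.

Definition Q u : K * K :=
  (u idx0 0, \sum_(i | idx_pos i) (u i 0)^b * u (opp i) 0).

Definition unitary : set 'M[K]_N :=
  [set s | [/\ s \in unitmx,
               forall u v, B (s *m u) (s *m v) = B u v
             & forall u, Delta (hsub F (Q (s *m u)) (Q u))]].

(* Booleans are coerced to exponents: with eps(i) = 1 for i > 0 and -1 for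
   i < 0, (eps(j) - 1) / 2 = - idx_neg j, (1 - eps(i)) / 2 = idx_neg i and
   - (1 + eps(i)) / 2 = - idx_pos i. *)
Definition T_short i j (x : K) : 'M[K]_N :=
  1 + x *: delta_mx i j
  - (lam ^- idx_neg j * x^b * lam ^+ idx_neg i) *: delta_mx (opp j) (opp i).

Definition T_extra i (a : K * K) : 'M[K]_N :=
  1 + a.1 *: delta_mx idx0 (opp i)
  - (lam ^- idx_pos i * a.1^b * mu) *: delta_mx i idx0
  + a.2 *: delta_mx i (opp i).

(* Om^{-eps(i)} *)
Definition twist Om i : set (K * K) :=
  if idx_pos i then [set a | Om (a.1, a.2^b)] else Om.

Definition short_transvections I : set 'M[K]_N :=
  [set s | exists i j x, [/\ idx_hb i && idx_hb j, (i != j) && (i != opp j),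
                             I x & s = T_short i j x]].

Definition extra_transvections Om : set 'M[K]_N :=
  [set s | exists i a, [/\ idx_hb i, twist Om i a & s = T_extra i a]].

Definition nontrivial_short : set 'M[K]_N :=
  short_transvections setT `&` [set s | s != 1].

Definition EU : set 'M[K]_N :=
  generated (short_transvections setT `|` extra_transvections Delta).

Definition EU_rel I Om : set 'M[K]_N :=
  normal_closure EU
    (generated (short_transvections I `|` extra_transvections Om)).

Definition U_rel I Om : set 'M[K]_N :=
  [set s | [/\ unitary s,
               forall i j, idx_hb i -> idx_hb j -> I (s i j - (i == j)%:R)
             & forall u, J (u idx0 0) -> Om (hsub F (Q (s *m u)) (Q u))]].

Definition NU_rel I Om : set 'M[K]_N := normaliser unitary (U_rel I Om).

Definition CU_rel I Om : set 'M[K]_N :=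
  [set s | NU_rel I Om s /\ commg_subgroup [set s] EU `<=` U_rel I Om].

(* For n >= 3 and H a subgroup of [unitary] normalised by [EU], exactly one
   pair (I, Om) satisfies this. *)
Definition has_level (H : set 'M[K]_N) I Om :=
  [/\ odd_form_ideal I Om, EU_rel I Om `<=` H & H `<=` CU_rel I Om].

Definition classes_of_level I Om : set (set 'M[K]_N) :=
  [set C | is_conj_class unitary C /\ has_level (generated C) I Om].

End Unitary.

Arguments Delta_submodule {K} h.
Arguments Delta_min_sub {K} h.
Arguments Delta_sub_max {K} h.
Arguments unitary {K} F n.
Arguments short_transvections {K} F n I.
Arguments extra_transvections {K} F n Om.
Arguments nontrivial_short {K} F n.
Arguments EU {K} F n.
Arguments EU_rel {K} F n I Om.
Arguments U_rel {K} F n I Om.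
Arguments NU_rel {K} F n I Om.
Arguments CU_rel {K} F n I Om.
Arguments classes_of_level {K} F n I Om.

(* Main.v *)
Require Import Defs.
From mathcomp Require Import all_boot all_order all_algebra ring zify.
From mathcomp Require Import boolp classical_sets.

(** In this situation every element of the unitary group fixes the coordinate
of index 0, hence the whole line of [e_0], and the group is the symplectic
group of the alternating form that [B] induces on the hyperplane [u_0 = 0].
Write [t_(u,a)] for the transvection [v |-> v + a B(u,v) u] and [t_u] for
[t_(u,1)]. The nontrivial short root transvections are the maps [v |-> v +
B(w,v) u + B(u,v) w] with [u], [w] independent and orthogonal; as the group is
transitive on the independent pairs with a given value of [B] (lemma
[isom_trans2]), they form one conjugacy class, so it suffices to hit a single
one of them.

Upper bound. Let [X] consist of the conjugates of [s <> 1] and of their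
inverses. The commutator of [s] with [t_(v,a)] is [t_(sv,a) t_(v,a)]. So if [s
v] is not a multiple of [v], transitivity puts into [X^2] all products
[t_(x,a) t_(y,a)] with [x], [y] independent and [B(x,y) = B(v,sv)].
- If [B(v,sv) = 0] for such a [v], then, for mutually orthogonal [x], [y],
  [z], the product [(t_x t_y)(t_z t_(x+y+z))] is the short root transvection
  of the pair [(x+z, y+z)]. See [isotropic_short_pow4].
- If [B(v,sv) <> 0] and some [c] is neither 0 nor 1, the coefficient [a] can
  be chosen such that [g = t_(x,a) t_(y,a)] has an eigenvector [p] of
  eigenvalue [c^2] in the plane of [x] and [y]. For [w] orthogonal to that
  plane, the commutator of [g] with the short root transvection of [(p,w)] is
  the one of [((c^2+1)p,w)], and it lies in [X^4]. See
  [anisotropic_short_pow4].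
- Otherwise the field has two elements and the vectors [v] with [B(v,sv) = 0]
  are the fixed vectors of [s]. As a quadratic form in three variables over
  this field has a nontrivial zero, [s] moves little: it is a transvection, or
  a product [t_u t_w] with [B(u,w) = 1] ([fixed_form_F2]). Three commuting
  transvections give a short root transvection; in the other case one inserts
  squares of transvections in [t_x t_y t_z t_(x+y+z)] to write it as four such
  products.

Lower bound. The conjugacy class of the transvections [t_(u,1)] generates all
the elementary transvections, so its level is the full one. A short root
transvection [g] satisfies [B(v,gv) = 0] for all [v] of the hyperplane, which
a product of at most two transvections [t_(u,1)] does not, unless it is 1. *)

Set Implicit Arguments.
Unset Strict Implicit.
Unset Printing Implicit Defensive.
Import GRing.Theory.
Local Open Scope classical_set_scope.
Local Open Scope ring_scope.

(** * Powers of subsets and least elements *)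

Section SetPowers.
Variable R : unitRingType.
Implicit Types (X : set R) (x y g : R).

Lemma set_pow1 X : set_pow X 1 = X.
Proof.
apply/seteqP; split=> [_ [f Xf <-]|x Xx]; first by rewrite big_ord1; apply: Xf.
by exists (fun=> x); rewrite ?big_ord1 // => i; apply: Xx.
Qed.

Lemma set_powM X m k x y :
  set_pow X m x -> set_pow X k y -> set_pow X (m + k) (x * y).
Proof.
move=> [f Xf <-] [h Xh <-].
exists (fun i => match split i with inl i => f i | inr i => h i end).
  by move=> i /=; case: split.
rewrite big_split_ord /=; congr (_ * _); apply: eq_bigr => i _.
  by rewrite -[lshift _ _]/(unsplit (inl i)) unsplitK.
by rewrite -[rshift _ _]/(unsplit (inr i)) unsplitK.
Qed.

Lemma conjM g x y : g \is a GRing.unit ->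
  g * (x * y) * g^-1 = (g * x * g^-1) * (g * y * g^-1).
Proof. by move=> ug; rewrite !mulrA divrK. Qed.

Lemma set_powJ X m g x : g \is a GRing.unit ->
    (forall y, X y -> X (g * y * g^-1)) ->
  set_pow X m x -> set_pow X m (g * x * g^-1).
Proof.
move=> ug XJ [f Xf <-]; exists (fun i => g * f i * g^-1) => [i|].
  exact/XJ/Xf.
elim: m f {Xf} => [|m IHm] f; first by rewrite !big_ord0 mulr1 divrr.
by rewrite !big_ord_recl IHm !mulrA divrK.
Qed.

(** The subgroup [H] only serves to make the elements of [A] units: the
intersection of the empty family of subgroups would be the whole ring. *)
Lemma generated_subgroup (H A : set R) : is_subgroup H -> A `<=` H ->
  is_subgroup (generated A).
Proof.
move=> hH AH; split=> [x|M [[]] //|x y hx hy M [hM AM]|x hx M [hM AM]].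
- by move/(smallest_sub hH AH); case: hH => HU _ _ _; apply: HU.
- by have [_ _ MM _] := hM; apply: MM; [apply: hx|apply: hy].
- by have [_ _ _ MV] := hM; apply: MV; apply: hx.
Qed.

End SetPowers.

Lemma least_or_oo_Some (P : set nat) k : least_or_oo P = Some k -> P k.
Proof.
rewrite /least_or_oo; case: pselect => // exP [<-].
by case: ex_minnP => m /asboolP.
Qed.

Lemma least_or_oo_some (P : set nat) m : P m ->
  exists k, [/\ least_or_oo P = Some k, (k <= m)%N & P k].
Proof.
move=> Pm; rewrite /least_or_oo; case: pselect => [exP|[]]; last first.
  by exists m; apply/asboolP.
exists (ex_minn exP); split=> //; case: ex_minnP => k /asboolP Pk km //.
exact/km/asboolP.
Qed.

(** * The bilinear form and its dual vectors *)

Section SymplecticGeometry.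
Variables (K : fieldType) (n : nat).
Local Notation N := (n.*2.+1).
Local Notation o := (idx0 n).
Implicit Types (u v w x y z : 'cV[K]_N) (s g : 'M[K]_N) (a b c : K).

(** The form [B] of the unitary group when the involution is trivial and
[lam = mu = 1]. *)
Definition form u v : K := \sum_i u i 0 * v (rev_ord i) 0.

Lemma form_rev u v : form u v = \sum_j u (rev_ord j) 0 * v j 0.
Proof.
rewrite /form (reindex_inj rev_ord_inj).
by apply: eq_bigr => i _; rewrite rev_ordK.
Qed.

Lemma formC u v : form u v = form v u.
Proof. by rewrite form_rev; apply: eq_bigr => i _; rewrite mulrC. Qed.

Lemma formDl u v w : form (u + v) w = form u w + form v w.
Proof. by rewrite -big_split; apply: eq_bigr => i _; rewrite !mxE mulrDl. Qed.

Lemma formZl a u w : form (a *: u) w = a * form u w.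
Proof. by rewrite mulr_sumr; apply: eq_bigr => i _; rewrite !mxE mulrA. Qed.

Lemma formDr u v w : form w (u + v) = form w u + form w v.
Proof. by rewrite formC formDl !(formC w). Qed.

Lemma formZr a u w : form w (a *: u) = a * form w u.
Proof. by rewrite formC formZl (formC w). Qed.

Lemma form0l w : form 0 w = 0.
Proof. by rewrite -(scale0r 0) formZl mul0r. Qed.

Lemma form0r w : form w 0 = 0. Proof. by rewrite formC form0l. Qed.

Definition formE := (formDl, formDr, formZl, formZr, form0l, form0r).

(** The hyperplane on which the form is alternating in characteristic 2. *)
Definition hyp v : Prop := v o 0 = 0.

Lemma hypD u v : hyp u -> hyp v -> hyp (u + v).
Proof. by rewrite /hyp mxE => -> ->; rewrite addr0. Qed.

Lemma hypZ a u : hyp u -> hyp (a *: u).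
Proof. by rewrite /hyp mxE => ->; rewrite mulr0. Qed.

Lemma rev_idx0 : rev_ord o = o.
Proof. by apply: val_inj; rewrite /= subSS -addnn addnK. Qed.

Definition bvec (i : 'I_N) : 'cV[K]_N := delta_mx i 0.

Lemma hyp_bvec i : idx_hb i -> hyp (bvec i).
Proof. by move=> /negbTE io; rewrite /hyp mxE eq_sym io. Qed.

Lemma form_bvecl i v : form (bvec i) v = v (rev_ord i) 0.
Proof.
rewrite /form (bigD1 i) //= big1 => [|j /negbTE ji]; rewrite !mxE ?eqxx.
  by rewrite mul1r addr0.
by rewrite ji mul0r.
Qed.

Lemma form_bvec i j : form (bvec i) (bvec j) = (rev_ord i == j)%:R.
Proof. by rewrite form_bvecl mxE eqxx andbT. Qed.

Lemma dual1 v : hyp v -> v != 0 -> exists2 z, hyp z & form v z = 1.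
Proof.
move=> hv v0; have [i vi] : exists i, v i 0 != 0.
  apply/existsP; apply: contraNT v0; rewrite negb_exists => /forallP vi0.
  by apply/eqP/colP => i; apply/eqP; have := vi0 i; rewrite negbK mxE.
have io : idx_hb (rev_ord i).
  rewrite /idx_hb -(inj_eq rev_ord_inj) rev_ordK rev_idx0.
  by apply: contraNneq vi => ->; rewrite hv.
exists ((v i 0)^-1 *: bvec (rev_ord i)); first exact/hypZ/hyp_bvec.
by rewrite formZr formC form_bvecl rev_ordK mulVf.
Qed.

Lemma form_nondeg v : hyp v -> (forall z, hyp z -> form v z = 0) -> v = 0.
Proof.
move=> hv vz; apply/eqP/negPn/negP => /(dual1 hv)[z hz].
by rewrite vz // => /eqP; rewrite eq_sym oner_eq0.
Qed.

(** Linear independence of two vectors of the hyperplane, in the form in which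
it is met when an isometry is applied to a vector. *)
Definition indep x y := [/\ hyp x, hyp y, x != 0 & forall c, y <> c *: x].

Lemma indep_sym x y : indep x y -> indep y x.
Proof.
move=> [hx hy x0 xy]; split=> //.
  by apply/eqP => y0; apply: (xy 0); rewrite scale0r.
move=> c xE; have [c0|c0] := eqVneq c 0.
  by move: x0; rewrite xE c0 scale0r eqxx.
by apply: (xy c^-1); rewrite xE scalerA mulVf ?scale1r.
Qed.

Lemma indep_det x y z w : hyp x -> hyp y ->
  form x z * form y w - form x w * form y z != 0 -> indep x y.
Proof.
move=> hx hy D; split=> // [|c yE].
  by apply: contraNneq D => ->; rewrite !formE; apply/eqP; ring.
by move: D; rewrite yE !formE => /eqP[]; ring.
Qed.

(** Subtracting from [y] a multiple of [x] makes it orthogonal to a vector dual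
to [x]; a vector dual to the difference is then corrected in the same way. *)
Lemma dual2 x y : indep x y ->
  exists z, [/\ hyp z, form x z = 0 & form y z = 1].
Proof.
move=> [hx hy x0 xy]; have [z hz xz] := dual1 hx x0.
pose y' := y - form y z *: x.
have [||z2 hz2 y'z2] := @dual1 y'.
- by apply/hypD => //; rewrite -scaleNr; apply/hypZ.
- by rewrite subr_eq0; apply/eqP/xy.
exists (z2 - form x z2 *: z); rewrite -scaleNr; split.
- by apply/hypD => //; apply/hypZ.
- by rewrite !formE xz mulr1 subrr.
- move: y'z2; rewrite /y' -scaleNr !formE => <-; ring.
Qed.

Lemma dual2_val x y a b : indep x y ->
  exists z, [/\ hyp z, form x z = a & form y z = b].
Proof.
move=> xy; have [z [hz xz yz]] := dual2 xy.
have [t [ht yt xt]] := dual2 (indep_sym xy).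
exists (a *: t + b *: z); split; first by apply/hypD; apply/hypZ.
- by rewrite !formE xz xt; ring.
- by rewrite !formE yz yt; ring.
Qed.

Lemma dual3_val x y w a b c : indep x y -> hyp w ->
    (forall p q, w <> p *: x + q *: y) ->
  exists z, [/\ hyp z, form x z = a, form y z = b & form w z = c].
Proof.
move=> xy hw wxy; have [hx hy _ _] := xy.
have [z1 [h1 x1 y1]] := dual2_val 1 0 xy.
have [z2 [h2 x2 y2]] := dual2_val 0 1 xy.
pose w' := w - (form w z1 *: x + form w z2 *: y).
have hw' : hyp w'.
  by rewrite /w' -scaleN1r; apply/hypD=> //; do ?[apply/hypZ|apply/hypD].
have [|z3 h3 w'3] := @dual1 w' hw'; first by rewrite subr_eq0; apply/eqP.
pose z4 := z3 + (- form x z3) *: z1 + (- form y z3) *: z2.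
have h4 : hyp z4 by do 2?[apply/hypD] => //; apply/hypZ.
have x4 : form x z4 = 0 by rewrite !formE x1 x2; ring.
have y4 : form y z4 = 0 by rewrite !formE y1 y2; ring.
have w4 : form w z4 = 1.
  by rewrite -w'3 /w' -scaleN1r !formE; ring.
clearbody z4.
exists (a *: z1 + b *: z2 + (c - a * form w z1 - b * form w z2) *: z4).
split; first by do 2?[apply/hypD] => //; apply/hypZ.
- by rewrite !formE x1 x2 x4; ring.
- by rewrite !formE y1 y2 y4; ring.
- by rewrite !formE w4; ring.
Qed.

(** The two halves of the standard hyperbolic basis; only the orthogonality
relations that certify independence through [indep_det] are recorded. *)
Lemma half_frame : exists f h : nat -> 'cV[K]_N,
  forall k l, (k < n)%N -> (l < n)%N ->
  [/\ hyp (f k), hyp (h k), form (f k) (f l) = 0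
    & form (f k) (h l) = (k == l)%:R].
Proof.
exists (fun k => bvec (inord k)), (fun k => bvec (rev_ord (inord k))).
move=> k l kn ln.
have kN : (k < N)%N by lia.
have lN : (l < N)%N by lia.
have hb : idx_hb (inord k : 'I_N) by rewrite /idx_hb -val_eqE /= inordK //; lia.
have hb' : idx_hb (rev_ord (inord k) : 'I_N).
  by rewrite /idx_hb -(inj_eq rev_ord_inj) rev_ordK rev_idx0.
split; do ?exact: hyp_bvec.
  rewrite form_bvec -val_eqE /= !inordK //.
  by suff -> : (N - k.+1 == l)%N = false by []; lia.
by rewrite form_bvec (inj_eq rev_ord_inj) -val_eqE /= !inordK.
Qed.

(** * Isometries and root elements *)

Definition transv u a : 'M[K]_N :=
  \matrix_(i, j) ((i == j)%:R + a * u i 0 * u (rev_ord j) 0).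

Definition short u w : 'M[K]_N :=
  \matrix_(i, j)
    ((i == j)%:R + u i 0 * w (rev_ord j) 0 + w i 0 * u (rev_ord j) 0).

Lemma sum_delta (i : 'I_N) v : \sum_j (i == j)%:R * v j 0 = v i 0.
Proof.
rewrite (bigD1 i) //= big1 => [|j]; first by rewrite eqxx mul1r addr0.
by rewrite eq_sym => /negbTE->; rewrite mul0r.
Qed.

Lemma transvE u a v : transv u a *m v = v + (a * form u v) *: u.
Proof.
apply/colP => i; rewrite !mxE form_rev.
under eq_bigr do rewrite mxE mulrDl.
rewrite big_split /= sum_delta mulr_sumr mulr_suml; congr (_ + _).
by apply: eq_bigr => j _; ring.
Qed.

Lemma shortE u w v : short u w *m v = v + form w v *: u + form u v *: w.
Proof.
apply/colP => i; rewrite !mxE !form_rev.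
under eq_bigr do rewrite mxE !mulrDl.
rewrite !big_split /= sum_delta !mulr_suml; congr (_ + _ + _).
  by apply: eq_bigr => j _; ring.
by apply: eq_bigr => j _; ring.
Qed.

Lemma mx_ext s g : (forall v, s *m v = g *m v) -> s = g.
Proof.
move=> sg; apply/matrixP => i j.
by have /colP/(_ i) := sg (bvec j); rewrite -!colE !mxE.
Qed.

Lemma mulrv s g v : (s * g) *m v = s *m (g *m v).
Proof. by rewrite mulmxA. Qed.

Lemma mul1v v : (1 : 'M[K]_N) *m v = v. Proof. exact: mul1mx. Qed.

(** The unitary group, freed from the form parameter: the condition on [Q]
says that the coordinate of index 0 is fixed (see [unitary_isom]). *)
Definition isom g :=
  [/\ g \is a GRing.unit, forall u v, form (g *m u) (g *m v) = form u v
    & forall v, (g *m v) o 0 = v o 0].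

Lemma isom1 : isom 1.
Proof. by split; [exact: unitr1|move=> *; rewrite !mul1v..]. Qed.

Lemma isomM g h : isom g -> isom h -> isom (g * h).
Proof.
move=> [ug fg og] [uh fh oh]; split; first by rewrite unitrMl.
- by move=> u v; rewrite !mulrv fg fh.
- by move=> v; rewrite !mulrv og oh.
Qed.

Lemma isomV g : isom g -> isom g^-1.
Proof.
move=> [ug fg og].
have gK v : g *m (g^-1 *m v) = v by rewrite -mulrv divrr ?mul1v.
split; first by rewrite unitrV.
- by move=> u v; rewrite -[LHS]fg !gK.
- by move=> v; rewrite -[LHS]og gK.
Qed.

Lemma isom_hyp g v : isom g -> hyp v -> hyp (g *m v).
Proof. by case=> _ _ og hv; rewrite /hyp og. Qed.

Lemma isom_indep g x y : isom g -> indep x y -> indep (g *m x) (g *m y).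
Proof.
move=> hg [hx hy x0 xy]; have [ug _ _] := hg.
have gK v : g^-1 *m (g *m v) = v by rewrite -mulrv mulVr ?mul1v.
split; do ?exact: isom_hyp.
- by apply: contraNneq x0 => gx; rewrite -(gK x) gx mulmx0.
- by move=> c E; apply: (xy c); rewrite -(gK y) E -scalemxAr gK.
Qed.

Lemma transvJ g u a : isom g -> g * transv u a * g^-1 = transv (g *m u) a.
Proof.
move=> [ug fg og]; apply: mx_ext => v.
rewrite !mulrv !transvE mulmxDr -scalemxAr -[form u _]fg.
by rewrite -!mulrv divrr // mul1v.
Qed.

Lemma shortJ g u w : isom g -> g * short u w * g^-1 = short (g *m u) (g *m w).
Proof.
move=> [ug fg og]; apply: mx_ext => v.
rewrite !mulrv !shortE !mulmxDr -!scalemxAr -[form u _]fg -[form w _]fg.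
by rewrite -!mulrv divrr // mul1v.
Qed.

Lemma involV s : s * s = 1 -> s^-1 = s.
Proof.
move=> ss; have us : s \is a GRing.unit by apply/unitrP; exists s.
by rewrite -[LHS]mulr1 -ss mulKr.
Qed.

(** * Root elements in characteristic two *)

Hypothesis charK : 2%N \in [pchar K].

Lemma two0 : 2 = 0 :> K. Proof. exact: pcharf0 charK. Qed.

Lemma addvv (V : lmodType K) (p : V) : p + p = 0.
Proof. by rewrite -mulr2n -scaler_nat two0 scale0r. Qed.

Lemma addr_eq0_char2 (V : lmodType K) (p q : V) : p + q = 0 -> p = q.
Proof. by move=> pq; rewrite -[p]addr0 -(addvv q) addrA pq add0r. Qed.

(** The terms of index [i] and [- i] cancel out. *)
Lemma form_self v : form v v = v o 0 ^+ 2.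
Proof.
rewrite /form (bigD1 o) //= rev_idx0 -expr2 -[RHS]addr0; congr (_ + _).
rewrite (bigID (fun i : 'I_N => (i < rev_ord i)%N)) /=.
rewrite [X in _ + X](reindex_inj rev_ord_inj) /=.
rewrite [X in _ + X](eq_bigl (fun i : 'I_N => (i != o) && (i < rev_ord i)%N)).
  rewrite [X in _ + X](eq_bigr (fun i => v i 0 * v (rev_ord i) 0)) => [|i _].
    by rewrite (addrr_pchar2 charK).
  by rewrite rev_ordK mulrC.
by move=> i; rewrite -!val_eqE /=; have := ltn_ord i; lia.
Qed.

Lemma form_alt v : hyp v -> form v v = 0.
Proof. by rewrite form_self => ->; rewrite expr0n. Qed.

Lemma form_indep x y : hyp x -> hyp y -> form x y != 0 -> indep x y.
Proof.
move=> hx hy xy; split=> // [|c yE].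
  by apply: contraNneq xy => ->; rewrite form0l.
by move: xy; rewrite yE formZr form_alt // mulr0 eqxx.
Qed.

Lemma transv_sq u a : hyp u -> transv u a * transv u a = 1.
Proof.
move=> hu; apply: mx_ext => v; rewrite mulrv mul1v !transvE !formE form_alt //.
by apply/colP => k; rewrite !mxE; ring: two0.
Qed.

Lemma transvV u a : hyp u -> (transv u a)^-1 = transv u a.
Proof. by move=> hu; apply/involV/transv_sq. Qed.

Lemma short_transv u w : form u w = 0 -> hyp u -> hyp w ->
  short u w = transv u 1 * transv w 1 * transv (u + w) 1.
Proof.
move=> uw hu hw; apply: mx_ext => v; rewrite !mulrv shortE !transvE !formE.
rewrite !form_alt // uw (formC w u) uw.
by apply/colP => k; rewrite !mxE; ring: two0.
Qed.

(** The tensors [x x + y y + z z + r r] with [r = x + y + z] of the commuting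
transvections add up to an alternating tensor, because the quadratic form
[B(x,v)^2 + ... + B(r,v)^2 = B(x+y+z+r,v)^2] vanishes; it has rank two. *)
Lemma short_transv4 x y z : hyp x -> hyp y -> hyp z ->
    form x y = 0 -> form x z = 0 -> form y z = 0 ->
  short (x + z) (y + z) =
  transv x 1 * transv y 1 * (transv z 1 * transv (x + y + z) 1).
Proof.
move=> hx hy hz xy xz yz; apply: mx_ext => v.
rewrite !mulrv shortE !transvE !formE !form_alt // (formC y x) (formC z x).
rewrite (formC z y) xy xz yz.
by apply/colP => k; rewrite !mxE; ring: two0.
Qed.

Lemma short_sq u w : hyp u -> hyp w -> form u w = 0 ->
  short u w * short u w = 1.
Proof.
move=> hu hw uw; apply: mx_ext => v.
rewrite !mulrv mul1v !shortE !formE !form_alt // (formC w u) uw.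
by apply/colP => k; rewrite !mxE; ring: two0.
Qed.

Lemma shortV u w : hyp u -> hyp w -> form u w = 0 -> (short u w)^-1 = short u w.
Proof. by move=> hu hw uw; apply/involV/short_sq. Qed.

Lemma short_mull p q w : hyp w ->
    form p w = 0 -> form q w = 0 -> form p q = 0 ->
  short p w * short q w = short (p + q) w.
Proof.
move=> hw pw qw pq; apply: mx_ext => v.
rewrite mulrv !shortE !formE (form_alt hw) pq pw (formC w q) qw.
by apply/colP => k; rewrite !mxE; ring: two0.
Qed.

(** The commutator formula for a short and a long root element, solved for the
long one. *)
Lemma transv_short3 u r w a : hyp w ->
    form u w = 0 -> form r w = 0 -> form r u = 1 -> hyp u -> hyp r ->
  transv w a = short (a *: r) w * (short (u + a *: r) w * short u w).
Proof.
move=> hw uw rw ru hu hr; apply: mx_ext => v.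
rewrite !mulrv !shortE !transvE !formE !form_alt // (formC w u) (formC w r).
rewrite uw rw ru; have three1 : 3 = 1 :> K by rewrite -[RHS]add0r -two0; ring.
by apply/colP => k; rewrite !mxE; ring: two0 three1.
Qed.

Lemma isom_transv u a : hyp u -> isom (transv u a).
Proof.
move=> hu; split.
- by apply/unitrP; exists (transv u a); rewrite transv_sq.
- by move=> v w; rewrite !transvE !formE form_alt // (formC v u); ring: two0.
- by move=> v; rewrite transvE !mxE hu mulr0 addr0.
Qed.

Lemma isom_short u w : hyp u -> hyp w -> form u w = 0 -> isom (short u w).
Proof.
by move=> hu hw uw; rewrite short_transv //; do 2?[apply: isomM];
  apply/isom_transv; do ?apply/hypD.
Qed.

(** If [s] is trivial on the hyperplane, then [s v - v] lies in it and is
orthogonal to it. *)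
Lemma isom_eq1 s : isom s -> (forall v, hyp v -> s *m v = v) -> s = 1.
Proof.
move=> hs sv; have [_ fs os] := hs; apply: mx_ext => v; rewrite mul1v.
apply: addr_eq0_char2; apply: form_nondeg => [|z hz].
  by rewrite /hyp mxE os; apply: (addrr_pchar2 charK).
by rewrite formDl -{1}(sv z hz) fs; apply: (addrr_pchar2 charK).
Qed.

(** An isometry that preserves all the lines of the hyperplane is a scalar [c]
there, and [c^2 = 1] forces [c = 1] in characteristic 2. *)
Lemma isom_moves s : isom s -> s != 1 ->
  exists2 v, hyp v & forall c, s *m v <> c *: v.
Proof.
move=> hs /eqP s1; apply: contrapT => N; apply: s1.
have ex v : hyp v -> exists c, s *m v = c *: v.
  move=> hv; apply: contrapT => Nv; apply: N; exists v => // c E.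
  by apply: Nv; exists c.
apply: isom_eq1 => // v hv.
have [->|v0] := eqVneq v 0; first by rewrite mulmx0.
have [z hz vz] := dual1 hv v0.
have [c sv] := ex v hv; have [d sz] := ex z hz.
have [e svz] := ex (v + z) (hypD hv hz).
move: svz; rewrite mulmxDr sv sz scalerDr => E.
have [_ fs _] := hs.
have cd : c * d = 1 by rewrite -vz -[RHS]fs sv sz !formE vz; ring.
have ce : c = e.
  move/(congr1 (form^~ z)): E; rewrite /= !formE (form_alt hz) vz.
  by rewrite !mulr0 !addr0 !mulr1.
have de : d = e.
  move/(congr1 (form^~ v)): E; rewrite /= !formE (form_alt hv) (formC z) vz.
  by rewrite !mulr0 !add0r !mulr1.
have /eqP : (c + 1) ^+ 2 = 0.
  by rewrite -(addrr_pchar2 charK 1) -{2}cd de -ce; ring: two0.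
by rewrite expf_eq0 /= addr_eq0 (oppr_pchar2 charK) => /eqP->; rewrite scale1r.
Qed.

(** * Transitivity on pairs of vectors *)

Lemma transv_move x y : hyp x -> hyp y -> form x y != 0 ->
  transv (x + y) (form x y)^-1 *m x = y.
Proof.
move=> hx hy xy; rewrite transvE !formE form_alt // add0r (formC y) mulVf //.
by rewrite scale1r addrA addvv add0r.
Qed.

(** One transvection moves [x] to a vector that is not orthogonal to it; in
general two steps, through a vector orthogonal to neither [x] nor [y], do. *)
Lemma isom_trans1 x y : hyp x -> hyp y -> x != 0 -> y != 0 ->
  exists2 g, isom g & g *m x = y.
Proof.
move=> hx hy x0 y0.
have step p q : hyp p -> hyp q -> form p q != 0 ->
    exists2 g, isom g & g *m p = q.
  move=> hp hq pq; exists (transv (p + q) (form p q)^-1).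
    by apply/isom_transv/hypD.
  exact: transv_move.
have [z [hz xz yz]] : exists z, [/\ hyp z, form x z != 0 & form z y != 0].
  have [[c yE]|xy] := pselect (exists c, y = c *: x).
    have [z hz xz] := dual1 hx x0; exists z; split=> //.
      by rewrite xz oner_eq0.
    rewrite yE formZr formC xz mulr1.
    by apply: contraNneq y0 => c0; rewrite yE c0 scale0r.
  have [|z [hz xz yz]] := @dual2_val x y 1 1.
    by split=> // c yE; apply: xy; exists c.
  by exists z; split=> //; rewrite ?xz ?(formC z) ?yz oner_eq0.
have [g hg gx] := step _ _ hx hz xz; have [h hh hzy] := step _ _ hz hy yz.
by exists (h * g); [apply: isomM|rewrite mulrv gx].
Qed.

(** The transvection that moves [y] to [y'] fixes [x], since its direction
[y + y'] is orthogonal to [x]. If [y] and [y'] are orthogonal, this is done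
twice, through a vector [z] orthogonal to neither. *)
Lemma isom_trans2_fix x y y' :
    indep x y -> indep x y' -> form x y = form x y' ->
  exists g, [/\ isom g, g *m x = x & g *m y = y'].
Proof.
move=> xy xy' E; have [hx hy x0 Nxy] := xy; have [_ hy' _ Nxy'] := xy'.
have step p q : hyp p -> hyp q -> form x p = form x q -> form p q != 0 ->
    exists g, [/\ isom g, g *m x = x & g *m p = q].
  move=> hp hq xpq pq; exists (transv (p + q) (form p q)^-1); split.
  - by apply/isom_transv/hypD.
  - rewrite transvE formDl (formC p x) (formC q x) xpq (addrr_pchar2 charK).
    by rewrite mulr0 scale0r addr0.
  - exact: transv_move.
have [yy'|] := eqVneq (form y y') 0; last exact: step.
have [yE|yNE] := eqVneq y y'.
  by exists 1; rewrite !mul1v; split=> //; apply: isom1.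
suff [z [hz xz yz y'z]] :
    exists z, [/\ hyp z, form x z = form x y, form y z != 0 & form z y' != 0].
  have [g [hg gx gy]] := step _ _ hy hz (esym xz) yz.
  have [|h [hh hx' hzy]] := step _ _ hz hy' _ y'z; first by rewrite xz.
  by exists (h * g); split; [apply: isomM|rewrite mulrv gx|rewrite mulrv gy].
have [[p [q y'E]]|Nlin] := pselect (exists p q, y' = p *: x + q *: y);
    last first.
  have [|z [hz xz yz y'z]] := @dual3_val x y y' (form x y) 1 1 xy hy'.
    by move=> p q y'E; apply: Nlin; exists p, q.
  by exists z; split; rewrite // 1?(formC z) ?yz ?y'z oner_eq0.
(* In the plane of [x] and [y], orthogonality of [y] and [y'] leaves only
   [y' = y] unless the plane is isotropic. *)
have [xy0|xy0] := eqVneq (form x y) 0; last first.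
  have p0 : p = 0.
    apply: (mulIf xy0); rewrite mul0r -yy' y'E !formE (form_alt hy) (formC y x).
    by ring.
  move: yNE; rewrite y'E p0 scale0r add0r.
  move: E; rewrite y'E p0 scale0r add0r formZr -{1}[form x y]mul1r.
  by move/(mulIf xy0) <-; rewrite scale1r eqxx.
have [z [hz xz yz]] := dual2 xy.
exists z; split; rewrite ?xz ?yz ?oner_eq0 ?xy0 // formC y'E !formE xz yz.
rewrite mulr0 mulr1 add0r; apply/eqP => q0.
by apply: (Nxy' p); rewrite y'E q0 scale0r addr0.
Qed.

Lemma isom_trans2 x y x' y' :
    indep x y -> indep x' y' -> form x y = form x' y' ->
  exists g, [/\ isom g, g *m x = x' & g *m y = y'].
Proof.
move=> xy xy' E; have [hx _ x0 _] := xy; have [hx' _ x'0 _] := xy'.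
have [g hg gx] := isom_trans1 hx hx' x0 x'0.
have [_ fg _] := hg; have xy2 := isom_indep hg xy; rewrite gx in xy2.
have [|h [hh hx'E hy']] := isom_trans2_fix xy2 xy'; first by rewrite -E -gx fg.
by exists (h * g); split; [apply: isomM|rewrite mulrv gx|rewrite mulrv].
Qed.

(** Three vectors of a totally isotropic subspace, which is where the dimension
is used, with the independent pairs needed for [short_transv4]. *)
Lemma isotropic_frame : (3 <= n)%N -> exists x y z,
  [/\ [/\ hyp x, hyp y & hyp z], [/\ form x y = 0, form x z = 0 & form y z = 0] &
   [/\ indep x y, indep z (x + y + z) & indep (x + z) (y + z)]].
Proof.
move=> n_ge3; have [f [h fh]] := half_frame.
have lt0 : (0 < n)%N by lia.
have lt1 : (1 < n)%N by lia.
have [hf0 _ _ fh00] := fh 0 0 lt0 lt0.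
have [hf1 _ _ fh10] := fh 1 0 lt1 lt0.
have [hf2 _ _ fh20] := fh 2 0 n_ge3 lt0.
have [_ _ f01 fh01] := fh 0 1 lt0 lt1.
have [_ _ _ fh11] := fh 1 1 lt1 lt1.
have [_ _ _ fh21] := fh 2 1 n_ge3 lt1.
have [_ _ f02 _] := fh 0 2 lt0 n_ge3.
have [_ _ f12 _] := fh 1 2 lt1 n_ge3.
have [_ _ _ fh22] := fh 2 2 n_ge3 n_ge3.
have hsum : hyp (f 0 + f 1 + f 2) by do 2?apply: hypD.
exists (f 0), (f 1), (f 2); split=> //; split.
- apply: (@indep_det _ _ (h 0) (h 1)) => //.
  by rewrite fh00 fh11 fh01 fh10 mulr0 subr0 mulr1 oner_eq0.
- apply: (@indep_det _ _ (h 2) (h 0)) => //.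
  by rewrite !formDl fh00 fh10 fh20 fh22 mul0r subr0 mul1r !addr0 oner_eq0.
- apply: (@indep_det _ _ (h 0) (h 1)); do ?apply: hypD => //.
  rewrite !formDl fh00 fh10 fh20 fh01 fh11 fh21 !addr0 mulr0 subr0 mulr1.
  exact: oner_neq0.
Qed.

Lemma orthogonal_pair w : (3 <= n)%N -> hyp w -> w != 0 -> exists u r,
  [/\ hyp u, hyp r, form u w = 0, form r w = 0 & form r u = 1].
Proof.
move=> n_ge3 hw w0.
have [x [y [_ [[hx hy _] [xy _ _] [Ixy _ _]]]]] := isotropic_frame n_ge3.
have [z [hz xz yz]] := dual2 Ixy; have [_ _ x0 _] := Ixy.
have [g hg <-] := isom_trans1 hx hw x0 w0; have [_ fg _] := hg.
exists (g *m z), (g *m y); split; do ?exact: isom_hyp; rewrite fg //.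
  by rewrite formC.
by rewrite formC.
Qed.

(** * Products of conjugates *)

Section Products.
Variable X : set 'M[K]_N.
Hypothesis XJ : forall g s, isom g -> X s -> X (g * s * g^-1).
Hypothesis XV : forall s, X s -> X s^-1.

Lemma powJ m g s : isom g -> set_pow X m s -> set_pow X m (g * s * g^-1).
Proof.
by move=> hg; apply: set_powJ => [|y]; [case: hg|apply: XJ].
Qed.

Lemma pow_transv2 m a x y x' y' :
    indep x y -> indep x' y' -> form x y = form x' y' ->
  set_pow X m (transv x a * transv y a) ->
  set_pow X m (transv x' a * transv y' a).
Proof.
move=> xy xy' E Xm; have [g [hg <- <-]] := isom_trans2 xy xy' E.
rewrite -!(transvJ _ _ hg) -conjM; last by case: hg.
exact: powJ.
Qed.

Lemma pow_short m x y x' y' :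
    indep x y -> indep x' y' -> form x y = 0 -> form x' y' = 0 ->
  set_pow X m (short x y) -> set_pow X m (short x' y').
Proof.
move=> xy xy' E E' Xm; have [|g [hg <- <-]] := isom_trans2 xy xy'.
  by rewrite E E'.
by rewrite -(shortJ _ _ hg); apply: powJ.
Qed.

(** The commutator of [s] with the transvection of direction [v]. *)
Lemma pow2_commutator s v a x y :
    X s -> isom s -> indep v (s *m v) -> indep x y ->
  form x y = form v (s *m v) -> set_pow X 2 (transv x a * transv y a).
Proof.
move=> Xs hs vsv xy E; have [hv hsv _ _] := vsv; have [us _ _] := hs.
apply: (@pow_transv2 _ _ (s *m v) v) => //; first exact: indep_sym.
  by rewrite formC.
have -> : transv (s *m v) a * transv v a =
    s * (transv v a * s^-1 * (transv v a)^-1).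
  by rewrite -(transvJ _ _ hs) transvV // !mulrA.
apply: (@set_powM _ _ 1 1); rewrite set_pow1 //.
by apply: XJ; [apply: isom_transv|apply: XV].
Qed.

Lemma indep_move s v : isom s -> hyp v -> (forall c, s *m v <> c *: v) ->
  indep v (s *m v).
Proof.
move=> hs hv Nv; split=> //; first exact: isom_hyp.
by apply/eqP => v0; apply: (Nv 0); rewrite v0 mulmx0 scaler0.
Qed.

Hypothesis n_ge3 : (3 <= n)%N.

(** Two commutators [t_(sv) t_v], moved to suitable pairs of a totally isotropic
space, multiply to a short root element. *)
Lemma isotropic_short_pow4 s v u w : X s -> isom s -> hyp v ->
    (forall c, s *m v <> c *: v) -> form v (s *m v) = 0 ->
  indep u w -> form u w = 0 -> set_pow X 4 (short u w).
Proof.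
move=> Xs hs hv Nv vsv0 uw uw0; have vsv := indep_move hs hv Nv.
have [x [y [z [[hx hy hz] [xy xz yz] [Ixy Iz I3]]]]] := isotropic_frame n_ge3.
apply: (pow_short I3 uw) => //.
  by rewrite !formE xy xz (formC z) yz form_alt // !addr0.
rewrite short_transv4 //; apply: (@set_powM _ _ 2 2).
  by apply: (pow2_commutator _ Xs hs vsv) => //; rewrite xy.
apply: (pow2_commutator _ Xs hs vsv) => //.
by rewrite !formE (formC z x) xz (formC z y) yz form_alt // vsv0 !addr0.
Qed.

(** On the plane of [x] and [y] the product has determinant 1 and trace
[(a form x y)^2], so that [c^2] is an eigenvalue as soon as this is
[c^2 + c^-2]. *)
Lemma eigen_transv2 x y a c :
    hyp x -> hyp y -> c != 0 -> a * form x y = c + c^-1 ->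
  (transv x a * transv y a) *m (c *: x + y) = c ^+ 2 *: (c *: x + y).
Proof.
move=> hx hy c0 ab; rewrite mulrv !transvE !formE !form_alt // (formC y x).
have e : a * form x y * c = c ^+ 2 + 1 by rewrite ab; field.
by apply/colP => k; rewrite !mxE; ring: two0 e.
Qed.

(** The product of two transvections is made to act on the plane of [x] and [y]
with the eigenvalue [c^2 <> 1]; its commutator with a root element in the
direction of the eigenvector is a root element again. *)
Lemma anisotropic_short_pow4 s v c u w : X s -> isom s -> hyp v ->
    form v (s *m v) != 0 -> c != 0 -> c != 1 ->
  indep u w -> form u w = 0 -> set_pow X 4 (short u w).
Proof.
move=> Xs hs hv b0 c0 c1 uw uw0.
have vsv := form_indep hv (isom_hyp hs hv) b0.
have [b bE] : exists b, form v (s *m v) = b by exists (form v (s *m v)).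
rewrite bE in b0.
have [f [h fh]] := half_frame.
have lt0 : (0 < n)%N by lia.
have lt1 : (1 < n)%N by lia.
have [hf0 hh0 f00 fh00] := fh 0 0 lt0 lt0.
have [hf1 _ f10 fh10] := fh 1 0 lt1 lt0.
have [_ _ f01 fh01] := fh 0 1 lt0 lt1.
have [_ _ f11 fh11] := fh 1 1 lt1 lt1.
have [y [hy xy yf1]] :
    exists y, [/\ hyp y, form (f 0) y = b & form y (f 1) = 0].
  exists (b *: h 0); split; first exact: hypZ.
    by rewrite formZr fh00 mulr1.
  by rewrite formZl formC fh10 mulr0.
pose x := f 0; pose a := (c + c^-1) / b.
have Ixy : indep x y by apply: form_indep; rewrite ?xy.
pose g := transv x a * transv y a; pose p := c *: x + y.
have hp : hyp p by apply: hypD => //; apply: hypZ.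
have hg : isom g by apply: isomM; apply: isom_transv.
have gp : g *m p = c ^+ 2 *: p.
  by apply: eigen_transv2 => //; rewrite xy divfK.
have gf1 : g *m f 1 = f 1.
  by rewrite mulrv !transvE yf1 mulr0 scale0r addr0 f01 mulr0 scale0r addr0.
have pf1 : form p (f 1) = 0 by rewrite !formE f01 yf1 mulr0 addr0.
have pf0 : form p (f 0) = b by rewrite !formE f00 (formC y) xy mulr0 add0r.
have Xg : set_pow X 2 g.
  by apply: (pow2_commutator _ Xs hs vsv Ixy); rewrite xy bE.
have XgV : set_pow X 2 g^-1.
  have -> : g^-1 = transv y a * transv x a.
    have [ux _ _] := isom_transv a hf0; have [uy _ _] := isom_transv a hy.
    by rewrite invrM // !transvV.
  apply: (pow2_commutator _ Xs hs vsv); first exact: indep_sym.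
  by rewrite formC xy bE.
have d0 : c ^+ 2 + 1 != 0.
  have -> : c ^+ 2 + 1 = (c + 1) ^+ 2 by ring: two0.
  by rewrite expf_eq0 /= addr_eq0 (oppr_pchar2 charK).
clearbody p; have Ip : indep ((c ^+ 2 + 1) *: p) (f 1).
  apply: (@indep_det _ _ (f 0) (h 1)) => //; first exact: hypZ.
  by rewrite fh11 f10 mulr0 subr0 mulr1 formZl pf0 mulf_neq0.
apply: (pow_short Ip uw) => //; first by rewrite formZl pf1 mulr0.
have -> : short ((c ^+ 2 + 1) *: p) (f 1) =
    g * (short p (f 1) * g^-1 * (short p (f 1))^-1).
  rewrite !mulrA shortJ // gp gf1 shortV // short_mull ?formE ?pf1 ?mulr0 //.
    by rewrite scalerDl scale1r.
  by rewrite form_alt ?mulr0.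
by apply: (@set_powM _ _ 2 2) => //; apply: powJ => //; apply: isom_short.
Qed.

End Products.

(** * The field with two elements *)

(** The quadratic form [q v = form v (s v)] takes the value 1 on every vector
that [s] moves. Multiplying [s] by the transvection of direction [s v0 + v0]
makes it fix [v0] without moving any fixed vector. After two such steps nothing
is left to move: if [v0], [v1], [v] were moved and independent modulo the fixed
vectors, [q] would be anisotropic of dimension three. *)
Lemma fixed_form_F2 s : (forall c, c = 0 \/ c = 1) -> isom s -> s != 1 ->
    (forall v, hyp v -> form v (s *m v) = 0 -> s *m v = v) ->
  (exists u, [/\ hyp u, u != 0 & s = transv u 1]) \/
  (exists u w, [/\ hyp u, hyp w, form u w = 1 & s = transv u 1 * transv w 1]).
Proof.
move=> F2 hs s1 fix0.
have F2n c : c != 0 -> c = 1 by case: (F2 c) => -> //; rewrite eqxx.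
pose q v := form v (s *m v); pose b v w := form v (s *m w) + form w (s *m v).
have qD v w : q (v + w) = q v + q w + b v w.
  by rewrite /q /b mulmxDr !formE; ring.
have bDr v w z : b v (w + z) = b v w + b v z.
  by rewrite /b mulmxDr !formE; ring.
have bC v w : b v w = b w v by rewrite /b addrC.
have [_ fs os] := hs.
have moved g : isom g -> g != 1 -> exists2 v, hyp v & g *m v <> v.
  move=> hg /(isom_moves hg)[v hv Nv]; exists v => // E.
  by apply: (Nv 1); rewrite scale1r.
have q1 v : hyp v -> s *m v <> v -> q v = 1.
  by move=> hv sv; apply: F2n; apply/eqP => /(fix0 v hv).
have [v0 hv0 sv0] := moved s hs s1.
have qv0 := q1 _ hv0 sv0.
pose u := s *m v0 + v0; have hu : hyp u by apply/hypD=> //; apply: isom_hyp.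
have us v : form u (s *m v) = form v0 v + form v0 (s *m v).
  by rewrite formDl fs.
have uE v : form u v = form (s *m v0) v + form v0 v by rewrite formDl.
pose s' := transv u 1 * s.
have hs' : isom s' by apply: isomM => //; apply: isom_transv.
have sE : s = transv u 1 * s' by rewrite mulrA transv_sq // mul1r.
have s'E v : s' *m v = s *m v + form u (s *m v) *: u.
  by rewrite mulrv transvE mul1r.
have s'fix v : hyp v -> q v = 0 -> s' *m v = v.
  move=> hv /(fix0 v hv) sv; rewrite s'E us sv.
  by rewrite (addrr_pchar2 charK) scale0r addr0.
have s'v0 : s' *m v0 = v0.
  rewrite s'E us form_alt // add0r -/(q v0) qv0 scale1r.
  by rewrite addrA addvv add0r.
have u0 : u != 0 by apply/eqP => /addr_eq0_char2.
clearbody u; have [s'1|s'1] := eqVneq s' 1.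
  by left; exists u; split=> //; rewrite sE s'1 mulr1.
have [v1 hv1 s'v1] := moved s' hs' s'1.
have qv1 : q v1 = 1 by apply: F2n; apply/eqP => /(s'fix _ hv1).
have bv01 : b v0 v1 = 1.
  apply: F2n; apply/eqP => b0.
  have : s' *m (v0 + v1) = v0 + v1.
    apply: s'fix; first exact: hypD.
    by rewrite qD qv0 qv1 b0 addr0 (addrr_pchar2 charK).
  by rewrite mulmxDr s'v0 => /addrI.
right; pose w := s' *m v1 + v1.
have hw : hyp w by apply/hypD=> //; apply: isom_hyp.
have [_ fs' _] := hs'.
have ws' v : form w (s' *m v) = form v1 v + form v1 (s' *m v).
  by rewrite formDl fs'.
have us1 : form u (s *m v1) + form u v1 = 1.
  by rewrite us uE -bv01 /b (formC (s *m v0)) (formC v1); ring: two0.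
have qv1' : form v1 (s' *m v1) = 1.
  rewrite s'E !formE -/(q v1) qv1 (formC v1 u).
  case: (F2 (form u v1)) => uv1; rewrite uv1 ?mulr0 ?addr0 //.
  have -> : form u (s *m v1) = 0.
    by move: us1; rewrite uv1 -[RHS]add0r => /addIr.
  by rewrite mul0r addr0.
have uw : form u w = 1.
  rewrite /w s'E !formE (form_alt hu) mulr0 addr0; exact: us1.
exists u, w; split=> //; rewrite {1}sE; congr (_ * _).
rewrite -[RHS]mulr1.
suff <- : transv w 1 * s' = 1 by rewrite mulrA transv_sq // mul1r.
apply: isom_eq1 => [|v hv]; first by apply: isomM => //; apply: isom_transv.
have tE z : (transv w 1 * s') *m z = s' *m z + form w (s' *m z) *: w.
  by rewrite mulrv transvE mul1r.
have tv1 : (transv w 1 * s') *m v1 = v1.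
  by rewrite tE ws' form_alt // add0r qv1' scale1r addrA addvv add0r.
have tfix z : hyp z -> s' *m z = z -> (transv w 1 * s') *m z = z.
  by move=> hz s'z; rewrite tE ws' s'z (addrr_pchar2 charK) scale0r addr0.
have tv0 := tfix _ hv0 s'v0.
have tq z : hyp z -> q z = 0 -> (transv w 1 * s') *m z = z.
  by move=> hz /(s'fix _ hz)/(tfix _ hz).
have cancelR z t : (transv w 1 * s') *m t = t ->
    (transv w 1 * s') *m (z + t) = z + t -> (transv w 1 * s') *m z = z.
  by move=> tt; rewrite mulmxDr tt => /addIr.
case: (F2 (q v)) => qv; first exact: tq.
case: (F2 (b v v0)) => bv0.
  apply: (cancelR v v0) => //; apply: tq; first exact: hypD.
  by rewrite qD qv qv0 bv0 addr0 (addrr_pchar2 charK).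
case: (F2 (b v v1)) => bv1.
  apply: (cancelR v v1) => //; apply: tq; first exact: hypD.
  by rewrite qD qv qv1 bv1 addr0 (addrr_pchar2 charK).
apply: (cancelR v (v0 + v1)); first by rewrite mulmxDr tv0 tv1.
apply: tq; first by do 2?apply: hypD.
by rewrite !qD bDr qv qv0 qv1 bv0 bv1 bv01 !(addrr_pchar2 charK) add0r addr0
  (addrr_pchar2 charK).
Qed.

(** * Four conjugates suffice *)

(** The exponent depends on [s] only: 3 for a transvection over the field with
two elements, and 4 otherwise. *)
Lemma short_pow_le4 (X : set 'M[K]_N) s : (3 <= n)%N ->
    (forall g t, isom g -> X t -> X (g * t * g^-1)) ->
    (forall t, X t -> X t^-1) -> X s -> isom s -> s != 1 ->
  exists m, (0 < m <= 4)%N /\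
    forall u w, indep u w -> form u w = 0 -> set_pow X m (short u w).
Proof.
move=> n_ge3 XJ XV Xs hs s1.
have [[v [hv Nv vsv]]|Nisotropic] := pselect (exists v,
    [/\ hyp v, forall c, s *m v <> c *: v & form v (s *m v) = 0]).
  exists 4%N; split=> // u w uw uw0.
  exact: (isotropic_short_pow4 XJ XV n_ge3 Xs hs hv Nv).
have [[c c0 c1]|Nc] := pselect (exists2 c : K, c != 0 & c != 1).
  have [v hv Nv] := isom_moves hs s1.
  exists 4%N; split=> // u w uw uw0.
  apply: (anisotropic_short_pow4 XJ XV n_ge3 Xs hs hv _ c0 c1) => //.
  by apply/eqP => vsv; apply: Nisotropic; exists v.
have F2 c : c = 0 \/ c = 1.
  have [->|c0] := eqVneq c 0; first by left.
  have [->|c1] := eqVneq c 1; first by right.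
  by case: Nc; exists c.
have [|[u [hu u0 sE]]|[u [w [hu hw uw sE]]]] := fixed_form_F2 F2 hs s1.
- move=> v hv vsv.
  have [[c svE]|Nv] := pselect (exists c, s *m v = c *: v); last first.
    by case: Nisotropic; exists v; split=> // c E; apply: Nv; exists c.
  case: (F2 c) svE => ->; rewrite ?scale1r // scale0r => sv0.
  have [us _ _] := hs; suff -> : v = 0 by rewrite mulmx0.
  by rewrite -[v]mul1v -(mulVr us) mulrv sv0 mulmx0.
- exists 3%N; split=> // v w vw vw0; have [hv hw v0 Nvw] := vw.
  have Xt z : hyp z -> z != 0 -> set_pow X 1 (transv z 1).
    move=> hz z0; have [g hg <-] := isom_trans1 hu hz u0 z0.
    by rewrite set_pow1 -transvJ //; apply: XJ; rewrite // -sE.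
  have [_ _ w0 _] := indep_sym vw.
  rewrite short_transv //; apply: (@set_powM _ _ 2 1); last first.
    apply: Xt; first exact: hypD.
    by apply/eqP => /addr_eq0_char2 E; apply: (Nvw 1); rewrite scale1r.
  by apply: (@set_powM _ _ 1 1); apply: Xt.
- exists 4%N; split=> // v v' vv' vv'0.
  have Xt x y : hyp x -> hyp y -> form x y = 1 ->
      set_pow X 1 (transv x 1 * transv y 1).
    move=> hx hy xy.
    have Ixy : indep x y by apply: form_indep; rewrite ?xy ?oner_eq0.
    have Iuw : indep u w by apply: form_indep; rewrite ?uw ?oner_eq0.
    by apply: (pow_transv2 XJ Iuw Ixy); rewrite ?uw ?xy // set_pow1 -sE.
  (* [z] cancels: the square of its transvection is 1. *)
  have Xo x y : indep x y -> set_pow X 2 (transv x 1 * transv y 1).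
    move=> Ixy; have [hx hy _ _] := Ixy.
    have [z [hz xz yz]] := dual2_val 1 1 Ixy.
    have -> : transv x 1 * transv y 1 =
        (transv x 1 * transv z 1) * (transv z 1 * transv y 1).
      by rewrite !mulrA -(mulrA (transv x 1)) transv_sq // mulr1.
    by apply: (@set_powM _ _ 1 1); apply: Xt => //; rewrite formC.
  have [x [y [z [[hx hy hz] [xy xz yz] [Ixy I1 I2]]]]] := isotropic_frame n_ge3.
  apply: (pow_short XJ I2 vv') => //.
    by rewrite !formE xy xz (formC z) yz form_alt // !addr0.
  by rewrite short_transv4 //; apply: (@set_powM _ _ 2 2); apply: Xo.
Qed.

(** * Two transvections do not suffice *)

Lemma short_self u w v : hyp v -> form v (short u w *m v) = 0.
Proof.
move=> hv; rewrite shortE !formE form_alt // (formC v u) (formC v w).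
by ring: two0.
Qed.

Lemma short_neq1 u w : indep u w -> short u w <> 1.
Proof.
move=> uw E; have [hu hw u0 _] := uw; have [z [hz uz wz]] := dual2 uw.
have : short u w *m z = z by rewrite E mul1v.
rewrite shortE uz wz scale1r scale0r addr0 -[RHS]addr0 => /addrI/eqP.
exact/negP.
Qed.

Lemma short_neq_transv u w x : hyp x -> x != 0 -> short u w <> transv x 1.
Proof.
move=> hx x0 E; have [z hz xz] := dual1 hx x0.
have := short_self u w hz; rewrite E transvE !formE form_alt // (formC z) xz.
by rewrite !mulr1 add0r => /eqP; rewrite oner_eq0.
Qed.

(** The function [v |-> form v (g v)] vanishes for a short root element [g].
For the product of the two transvections it is a quadratic form that does not
vanish at [z] with [form x z = 1] and [form y z = 0]; when there is no such [z],
the vectors [x] and [y] are proportional and the form vanishes only if they are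
equal. *)
Lemma short_neq_transv2 u w x y : indep u w -> hyp x -> hyp y -> x != 0 ->
  short u w <> transv x 1 * transv y 1.
Proof.
move=> uw hx hy x0 E.
have qE z : hyp z ->
    form x z ^+ 2 + form y z ^+ 2 + form x y * form x z * form y z = 0.
  move=> hz; rewrite -(short_self u w hz) E mulrv !transvE !formE form_alt //.
  by rewrite (formC z x) (formC z y); ring.
have [[c yE]|Nxy] := pselect (exists c, y = c *: x); last first.
  have [|z [hz xz yz]] := @dual2_val x y 1 0.
    by split=> // c yE; apply: Nxy; exists c.
  have /eqP := qE z hz; rewrite xz yz expr1n expr0n mulr0 !addr0.
  by rewrite oner_eq0.
have [z hz xz] := dual1 hx x0.
have : (c + 1) ^+ 2 = 0.
  rewrite -(qE z hz) yE !formE xz form_alt //; ring: two0.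
move/eqP; rewrite expf_eq0 /= addr_eq0 (oppr_pchar2 charK) => /eqP c1.
by apply: (short_neq1 uw); rewrite E yE c1 scale1r transv_sq.
Qed.

End SymplecticGeometry.

(** * The unitary group *)

Section EvenCharacteristicUnitary.
Variables (K : fieldType) (F : herm_form_field K) (n : nat).
Hypotheses (charK : 2%N \in [pchar K]) (bar_id : forall x : K, bar F x = x).
Hypotheses (lamE : lam F = -1) (muE : mu F = 1).
Hypothesis Delta_eq : Delta F = [set 0] `*` setT.
Local Notation N := (n.*2.+1).
Local Notation o := (idx0 n).
Local Notation G := (unitary F n).
Local Notation sym C := (C `|` [set x^-1 | x in C]).
Implicit Types (u v w : 'cV[K]_N) (s g h : 'M[K]_N).

Lemma lam1 : lam F = 1.
Proof. by rewrite lamE (oppr_pchar2 charK). Qed.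

Lemma DeltaE (a : K * K) : Delta F a = (a.1 = 0).
Proof. by rewrite Delta_eq; apply/propext; split=> [[]|]. Qed.

Lemma B_form u v : B F u v = form u v.
Proof.
rewrite /B /form [RHS](bigID (fun i : 'I_N => idx_pos i)) /= -addrA.
congr (_ + _).
  by apply: eq_bigr => i _; rewrite bar_id.
rewrite [RHS](bigD1 o) /=; last by rewrite /idx_pos /= ltnn.
rewrite bar_id muE mulr1 rev_idx0; congr (_ + _).
apply: eq_big => [i|i _]; last by rewrite bar_id lam1 mulr1.
by rewrite /idx_pos /idx_neg -val_eqE /=; lia.
Qed.

Lemma unitary_isom : G = [set s | isom s].
Proof.
apply/seteqP; split=> s [us fs Qs]; split=> //.
- by move=> u v; rewrite -!B_form.
- by move=> v; have := Qs v; rewrite DeltaE /= => /subr0_eq.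
- by move=> u v; rewrite !B_form.
- by move=> u; rewrite DeltaE /= Qs subrr.
Qed.

Lemma T_short_short (i j : 'I_N) (x : K) :
  T_short F i j x = short (bvec K i) (x *: bvec K (rev_ord j)).
Proof.
apply/matrixP => k l; rewrite !mxE bar_id lam1 !expr1n invr1 mul1r mulr1 andbT.
rewrite (oppr_pchar2 charK) !andbT.
rewrite (inj_eq rev_ord_inj) -(inj_eq rev_ord_inj (rev_ord l)) rev_ordK.
case: (k == i); case: (l == j); case: (k == rev_ord j);
  case: (l == rev_ord i); rewrite /=; ring.
Qed.

Lemma T_extra_transv (i : 'I_N) (a : K * K) : a.1 = 0 ->
  T_extra F i a = transv (bvec K i) a.2.
Proof.
move=> a0; apply/matrixP => k l; rewrite !mxE a0 rmorph0 mul0r mulr0 mul0r.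
rewrite mul0r addr0 subr0 !andbT -(inj_eq rev_ord_inj (rev_ord l)) rev_ordK.
by case: (k == i); case: (l == rev_ord i); rewrite /= ?mulr0 ?mulr1 ?mul0r.
Qed.

Lemma twist_Delta (i : 'I_N) (a : K * K) : twist F (Delta F) i a -> a.1 = 0.
Proof. by rewrite /twist; case: ifP => _ /=; rewrite DeltaE. Qed.

Lemma short_transvection_cond (i j : 'I_N) (x : K) :
    idx_hb i && idx_hb j -> (i != j) && (i != rev_ord j) ->
  [/\ hyp (bvec K i), hyp (x *: bvec K (rev_ord j)),
      form (bvec K i) (x *: bvec K (rev_ord j)) = 0 &
      x != 0 -> indep (bvec K i) (x *: bvec K (rev_ord j))].
Proof.
move=> /andP[hi hj] /andP[ij irj].
have hrj : idx_hb (rev_ord j).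
  by rewrite /idx_hb -(inj_eq rev_ord_inj) rev_ordK rev_idx0.
have hri : idx_hb (rev_ord i).
  by rewrite /idx_hb -(inj_eq rev_ord_inj) rev_ordK rev_idx0.
have e0 : form (bvec K i) (bvec K (rev_ord j)) = 0.
  by rewrite form_bvec (inj_eq rev_ord_inj) (negbTE ij).
split; do ?[exact: hyp_bvec | exact/hypZ/hyp_bvec].
  by rewrite formZr e0 mulr0.
move=> x0; apply: (@indep_det _ _ _ _ (bvec K (rev_ord i)) (bvec K j)).
- exact: hyp_bvec.
- exact/hypZ/hyp_bvec.
rewrite !formZl !form_bvec !rev_ordK !eqxx.
have -> : (rev_ord i == j) = false.
  by rewrite -(inj_eq rev_ord_inj) rev_ordK (negbTE irj).
by rewrite mul0r subr0 mul1r mulr1.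
Qed.

Lemma unitary_subgroup : is_subgroup G.
Proof.
rewrite unitary_isom; split=> [s []|||] //; first exact: isom1.
- exact: isomM.
- exact: isomV.
Qed.

Lemma generators_unitary :
  short_transvections F n setT `|` extra_transvections F n (Delta F) `<=` G.
Proof.
rewrite unitary_isom => s [[i [j [x [hij ij _ ->]]]]|[i [a [hi ha ->]]]] /=.
  have [hu hw uw _] := short_transvection_cond x hij ij.
  by rewrite T_short_short; apply: isom_short.
by rewrite T_extra_transv ?(twist_Delta ha) //; apply/isom_transv/hyp_bvec.
Qed.

Lemma EU_unitary : EU F n `<=` G.
Proof.
by apply: smallest_sub; [apply: unitary_subgroup|apply: generators_unitary].
Qed.

Lemma EU_subgroup : is_subgroup (EU F n).
Proof. exact: generated_subgroup unitary_subgroup generators_unitary. Qed.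

Lemma EU_rel_EU : EU_rel F n setT (Delta F) `<=` EU F n.
Proof.
apply: smallest_sub => //; split=> //; first exact: EU_subgroup.
move=> g h hg hh; have [_ _ EM EV] := EU_subgroup.
exact: EM (EM _ _ hg hh) (EV _ hg).
Qed.

Lemma level_form_ideal : odd_form_ideal F setT (Delta F).
Proof.
split=> //; first exact: Delta_submodule.
- move=> _ [_ [x _ <-]] [b hb <-]; rewrite DeltaE /= add0r.
  have [sub act] := Delta_submodule F.
  suff : Delta F b by rewrite DeltaE.
  by move: b hb; apply: smallest_sub => // _ [a ha] [k _ <-]; apply: act.
Qed.

Lemma U_rel_full : U_rel F n setT (Delta F) = G.
Proof. by apply/seteqP; split=> [s []|s Gs] //; split=> // u _; case: Gs. Qed.

(** At the full level the upper end of the sandwich is the whole group, so that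
a class has this level exactly when it generates the elementary group. *)
Lemma CU_rel_full : CU_rel F n setT (Delta F) = G.
Proof.
have [subG G1 GM GV] := unitary_subgroup.
rewrite /CU_rel /NU_rel U_rel_full; apply/seteqP; split=> [s [[]]|s Gs] //.
split; first split=> //.
  apply/seteqP; split=> [_ [h Gh <-]|h Gh].
    exact: GM (GM _ _ Gs Gh) (GV _ Gs).
  exists (s^-1 * h * s); first exact: GM (GM _ _ (GV _ Gs) Gh) Gs.
  by rewrite !mulrA divrr ?subG // mul1r mulrK ?subG.
apply: smallest_sub; first exact: unitary_subgroup.
move=> _ [x [y [-> /EU_unitary Gy ->]]].
by apply: (GM); [apply: (GM); [apply: (GM)|]|]; do ?apply: (GV).
Qed.

Lemma conj_class_isomJ (C : set 'M[K]_N) g s : is_conj_class G C ->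
  isom g -> C s -> C (g * s * g^-1).
Proof.
rewrite unitary_isom => -[x Gx ->] hg [h hh <-].
exists (g * h); first exact: isomM.
have [ug _ _] := hg; have [uh _ _] := hh.
by rewrite invrM // !mulrA.
Qed.

Lemma conj_class_sub (C : set 'M[K]_N) : is_conj_class G C -> C `<=` G.
Proof.
have [_ _ GM GV] := unitary_subgroup.
move=> [x Gx ->] _ [g Gg <-]; apply: (GM); first exact: GM.
exact: GV.
Qed.

Lemma sym_class (C : set 'M[K]_N) : is_conj_class G C ->
  (forall g s, isom g -> sym C s -> sym C (g * s * g^-1)) /\
  (forall s, sym C s -> sym C s^-1).
Proof.
move=> hC; split=> [g s hg [Cs|[t Ct <-]]|s [Cs|[t Ct <-]]].
- by left; apply: conj_class_isomJ.
- right; exists (g * t * g^-1); first exact: conj_class_isomJ.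
  have [ug _ _] := hg; have [sG _ _ _] := unitary_subgroup.
  have ut : t \is a GRing.unit by apply/sG/(conj_class_sub hC).
  by rewrite invrM ?unitrV ?unitrMl // invrM // invrK mulrA.
- by right; exists s.
- by left; rewrite invrK.
Qed.

Hypothesis n_ge3 : (3 <= n)%N.

Lemma exists_nontrivial_short : exists2 s, nontrivial_short F n s &
  exists u w, [/\ indep u w, form u w = 0 & s = short u w].
Proof.
(* The ordinals 0 and 1 stand for the indices 1 and 2. *)
pose i : 'I_N := inord 0; pose j : 'I_N := inord 1.
have vi : val i = 0%N by rewrite /= inordK.
have vj : val j = 1%N by rewrite /= inordK //; lia.
have hij : idx_hb i && idx_hb j by rewrite /idx_hb -!val_eqE vi vj /=; lia.
have ij : (i != j) && (i != rev_ord j) by rewrite -!val_eqE /= vi vj; lia.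
have [hu hw uw I] := short_transvection_cond 1 hij ij.
have {I}I := I (oner_neq0 _).
exists (T_short F i j 1); last first.
  by rewrite T_short_short; exists (bvec K i), (1 *: bvec K (rev_ord j)).
split; first by exists i, j, 1.
by rewrite T_short_short /=; apply/eqP => E; exact: (short_neq1 I E).
Qed.

Lemma level_class_neq1 (C : set 'M[K]_N) :
  classes_of_level F n setT (Delta F) C ->
  exists2 s, C s & s != 1.
Proof.
move=> [hC [_ EC _]].
have [s [Ss /eqP s1] _] := exists_nontrivial_short.
apply: contrapT => N1; apply: s1.
have : generated C s.
  by apply: EC => M [_ genM]; apply: genM => M' [_]; apply; left.
suff : generated C `<=` [set 1] by apply.
apply: smallest_sub; last first.
  by move=> t Ct /=; apply/eqP/negPn/negP => t1; apply: N1; exists t.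
split=> [_ ->||_ _ -> ->|_ ->] //=; rewrite ?mulr1 ?invr1 //; exact: unitr1.
Qed.

Lemma scn_short_le4 (C : set 'M[K]_N) :
  classes_of_level F n setT (Delta F) C ->
  exists2 k, scn C (nontrivial_short F n) = Some k & (k <= 4)%N.
Proof.
move=> CC; have [hC _] := CC; have [s Cs s1] := level_class_neq1 CC.
have [XJ XV] := sym_class hC.
have hs : isom s by have := conj_class_sub hC Cs; rewrite unitary_isom.
have [|m [/andP[m0 m4] Xm]] := short_pow_le4 charK n_ge3 XJ XV _ hs s1.
  by left.
have [|k [kE km _]] := @least_or_oo_some
  [set m | (0 < m)%N /\ nontrivial_short F n `<=` set_pow (sym C) m] m.
  split=> // _ [[i [j [x [hij ij _ ->]]]] /eqP s1'].
  have [hu hw uw I] := short_transvection_cond x hij ij.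
  move: s1'; rewrite T_short_short => s1'; apply: Xm => //; apply: I.
  apply/eqP => x0; apply: s1'; rewrite x0 scale0r.
  by apply: mx_ext => v; rewrite shortE mul1v !formE scale0r scaler0 !addr0.
by exists k; [exact: kE|apply: leq_trans m4].
Qed.

(** * The class of the transvections *)

(** Over an imperfect field this is not the class of all the transvections:
[transv u a] belongs to it only if [a] is a square. *)
Definition transv_class : set 'M[K]_N :=
  [set s | exists u, [/\ hyp u, u != 0 & s = transv u 1]].

Lemma transv_class_conj : is_conj_class G transv_class.
Proof.
have [f [h fh]] := half_frame K n.
have lt0 : (0 < n)%N by lia.
have [hf hh _ fh1] := fh 0 0 lt0 lt0.
have f0 : f 0%N != 0.
  by apply/eqP => E; move/eqP: fh1; rewrite E form0l eq_sym oner_eq0.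
exists (transv (f 0%N) 1); rewrite unitary_isom; first exact: isom_transv.
apply/seteqP; split=> [_ [u [hu u0 ->]]|_ [g hg <-]].
  have [g hg <-] := isom_trans1 charK hf hu f0 u0.
  by exists g => //; rewrite transvJ.
exists (g *m f 0%N); split; [exact: isom_hyp| |by rewrite transvJ].
have [ug _ _] := hg; apply: contraNneq f0 => E.
by rewrite -[f 0%N]mul1v -(mulVr ug) mulrv E mulmx0.
Qed.

(** Products of three elements of the class give all the short root elements by
[short_transv], and from these [transv_short3] makes the long root elements with
arbitrary coefficients. *)
Lemma transv_class_level : classes_of_level F n setT (Delta F) transv_class.
Proof.
have hC := transv_class_conj; split=> //; split.
- exact: level_form_ideal.
- apply: subset_trans EU_rel_EU _; apply: smallest_sub.
    exact: generated_subgroup unitary_subgroup (conj_class_sub hC).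
  have [_ H1 HM HV] := generated_subgroup unitary_subgroup (conj_class_sub hC).
  have Ht u : hyp u -> generated transv_class (transv u 1).
    move=> hu; have [->|u0] := eqVneq u 0.
      suff -> : transv 0 1 = 1 :> 'M[K]_N by [].
      by apply: mx_ext => v; rewrite transvE mul1v scaler0 addr0.
    by apply: sub_gen_smallest; exists u.
  have Hs u w : hyp u -> hyp w -> form u w = 0 ->
      generated transv_class (short u w).
    move=> hu hw uw; rewrite short_transv //.
    exact: HM (HM _ _ (Ht _ hu) (Ht _ hw)) (Ht _ (hypD hu hw)).
  move=> _ [[i [j [x [hij ij _ ->]]]]|[i [a [hi ha ->]]]].
    have [hu hw uw _] := short_transvection_cond x hij ij.
    by rewrite T_short_short; apply: (Hs).
  rewrite T_extra_transv ?(twist_Delta ha) //.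
  have hw := hyp_bvec K hi; move: (a.2) => y; set w := bvec K i in hw *.
  have w0 : w != 0.
    apply/eqP => /matrixP/(_ i 0); rewrite !mxE !eqxx => /eqP.
    by rewrite oner_eq0.
  have [u [r [hu hr uw rw ru]]] := orthogonal_pair charK n_ge3 hw w0.
  have -> : transv w y = short (y *: r) w * (short (u + y *: r) w * short u w).
    exact: transv_short3.
  apply: (HM); first by apply: (Hs); rewrite ?formZl ?rw ?mulr0 //; apply: hypZ.
  apply: (HM); last exact: Hs.
  apply: (Hs) => //; first by apply: hypD => //; apply: hypZ.
  by rewrite !formE uw rw mulr0 addr0.
- rewrite CU_rel_full; apply: smallest_sub; first exact: unitary_subgroup.
  exact: conj_class_sub.
Qed.

Lemma scn_transv_class k : scn transv_class (nontrivial_short F n) = Some k ->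
  (2 < k)%N.
Proof.
move=> /least_or_oo_Some[k0 Sk]; rewrite ltnNge; apply/negP => k2.
have symC s : sym transv_class s ->
    exists u, [/\ hyp u, u != 0 & s = transv u 1].
  by move=> [//|[_ [u [hu u0 ->]] <-]]; exists u; split=> //; rewrite transvV.
have [s Ss [u [w [uw uw0 sE]]]] := exists_nontrivial_short.
have := Sk _ Ss; rewrite sE; case: k k0 k2 {Sk} => [|[|[|]]] // _ _.
  rewrite set_pow1 => /symC[x [hx x0]].
  exact: short_neq_transv.
move=> [f Xf]; rewrite !big_ord_recl big_ord0 mulr1.
have [x [hx x0 ->]] := symC _ (Xf ord0).
have [y [hy y0 ->]] := symC _ (Xf (lift ord0 ord0)).
move=> E; exact: (short_neq_transv2 charK uw hx hy x0 (esym E)).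
Qed.

End EvenCharacteristicUnitary.

Theorem theorem35 (K : fieldType) (F : herm_form_field K) (n : nat)
  (charK : 2%N \in [pchar K])
  (bar_id : forall x : K, bar F x = x)
  (lamE : lam F = -1)
  (muE : mu F = 1)
  (Delta_eq_max : Delta F = Delta_max F)
  (Delta_eq : Delta F = [set 0] `*` setT)
  (n_ge3 : (3 <= n)%N) :
  scn_family (classes_of_level F n setT (Delta F)) (nontrivial_short F n) = Some 3%N
  \/ scn_family (classes_of_level F n setT (Delta F)) (nontrivial_short F n) = Some 4%N.
Proof.
have le4 C := @scn_short_le4 _ F n charK bar_id lamE muE Delta_eq n_ge3 C.
have lev := transv_class_level charK bar_id lamE muE Delta_eq n_ge3.
have gt2 k := @scn_transv_class _ F n charK bar_id lamE n_ge3 k.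
have [|m [E m4]] := @least_or_oo_some [set m | forall a,
    [set scn X (nontrivial_short F n) | X in classes_of_level F n setT (Delta F)] a ->
    exists2 k, a = Some k & (k <= m)%N] 4.
  by move=> _ [C hC <-]; apply: le4.
move=> /(_ _ (ex_intro2 _ _ _ lev erefl))[k /gt2 k2 km].
rewrite /scn_family /nat_oo_sup E.
have : (2 < m)%N by apply: leq_trans km.
by case: m m4 {E km} => [|[|[|[|[|]]]]] // _ _; [left|right].
Qed.
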